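(* For every finite undirected graph $G=(V,E)$ and every threshold function $t:V\to\mathbb{N}$, every execution of the algorithm MTS on input $(G,t)$ outputs a target set $S$ with $$|S|\le\sum_{v\in V}\min\left(1,\frac{t(v)}{d(v)+1}\right),$$ where $d(v)$ is the degree of $v$ in $G$.
   Context: Graphs are finite, without loops. An undirected graph is treated as the bidirected digraph in which each edge $\{u,v\}$ is replaced by the two arcs $(u,v),(v,u)$. For a digraph $G=(V,E)$ and $v\in V$, $\Gamma^{in}(v)=\{u:(u,v)\in E\}$ and $\Gamma^{out}(v)=\{u:(v,u)\in E\}$. Given thresholds $t:V\to\mathbb{N}=\{0,1,2,\dots\}$ and $S\subseteq V$, the activation process starting at $S$ is $A_0=S$ and $A_\ell=A_{\ell-1}\cup\{u\in V: |\Gamma^{in}(u)\cap A_{\ell-1}|\ge t(u)\}$ for $\ell\ge1$. $S$ is a target set for $(G,t)$ if $A_\lambda=V$ for some $\lambda\ge0$. Algorithm MTS on input $(G,t)$: set $S=\emptyset$, $L=\emptyset$, $U=V$, and for each $v\in V$ set $k(v)=t(v)$, $\delta(v)=|\Gamma^{in}(v)|$. While $U\neq\emptyset$, perform one iteration as follows. Case 1: if some $v\in U$ has $k(v)=0$, select such a $v$; for each $u\in\Gamma^{out}(v)\cap U$ set $k(u)=\max(k(u)-1,0)$ and, if $v\notin L$, set $\delta(u)=\delta(u)-1$; then set $U=U\setminus\{v\}$. Case 2: otherwise, if some $v\in U\setminus L$ has $\delta(v)<k(v)$, select such a $v$; set $S=S\cup\{v\}$; for each $u\in\Gamma^{out}(v)\cap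 U$ set $k(u)=k(u)-1$ and $\delta(u)=\delta(u)-1$; then set $U=U\setminus\{v\}$. Case 3: otherwise, select $v\in U\setminus L$ maximizing $\frac{k(u)}{\delta(u)(\delta(u)+1)}$ over $u\in U\setminus L$; for each $u\in\Gamma^{out}(v)\cap U$ set $\delta(u)=\delta(u)-1$; set $L=L\cup\{v\}$. When $U=\emptyset$, return $S$. Whenever several nodes qualify in a case, one of them is chosen arbitrarily. *)

(* Defs.v *)
From HB Require Import structures.
From mathcomp Require Import all_boot all_order all_algebra.
From Stdlib Require Import Relation_Operators.
Set Implicit Arguments.
Unset Strict Implicit.
Unset Printing Implicit Defensive.
Import Order.TTheory GRing.Theory Num.Theory.
Local Open Scope ring_scope.

(* A digraph on V is its arc relation [e : rel V]; an undirected graph is the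
   bidirected digraph, i.e. a symmetric (and irreflexive, no loops) relation. *)

Definition nbr_in (V : finType) (e : rel V) (v : V) : {set V} := [set u | e u v].
Definition nbr_out (V : finType) (e : rel V) (v : V) : {set V} := [set u | e v u].

Definition is_undirected (V : finType) (e : rel V) : Prop :=
  symmetric e /\ irreflexive e.

(* Meant for undirected graphs, where in- and out-neighbours coincide. *)
Definition degree (V : finType) (e : rel V) (v : V) : nat := #|nbr_out e v|.

Fixpoint activation (V : finType) (e : rel V) (t : V -> nat) (S : {set V})
    (l : nat) : {set V} :=
  if l is l'.+1 then
    let A := activation e t S l' in
    A :|: [set u | (t u <= #|nbr_in e u :&: A|)%N]
  else S.

Definition is_target_set (V : finType) (e : rel V) (t : V -> nat)
    (S : {set V}) : Prop :=
  exists l : nat, activation e t S l = [set: V].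

(* The counters k and delta are integers, so that "- 1" is never truncated. *)
Record mts_state (V : finType) := MtsState {
  st_S : {set V};
  st_L : {set V};
  st_U : {set V};
  st_k : V -> int;
  st_delta : V -> int
}.

Definition mts_init (V : finType) (e : rel V) (t : V -> nat) : mts_state V :=
  {| st_S := set0; st_L := set0; st_U := [set: V];
     st_k := fun v => (t v)%:Z;
     st_delta := fun v => #|nbr_in e v|%:Z |}.

Definition case1_node (V : finType) (s : mts_state V) (v : V) : bool :=
  (v \in st_U s) && (st_k s v == 0).

Definition case2_node (V : finType) (s : mts_state V) (v : V) : bool :=
  (v \in st_U s :\: st_L s) && (st_delta s v < st_k s v).

Definition mts_ratio (V : finType) (s : mts_state V) (u : V) : rat :=
  (st_k s u)%:~R / ((st_delta s u)%:~R * ((st_delta s u)%:~R + 1)).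

Definition case3_node (V : finType) (s : mts_state V) (v : V) : Prop :=
  v \in st_U s :\: st_L s /\
  forall u, u \in st_U s :\: st_L s -> mts_ratio s u <= mts_ratio s v.

Definition mts_update1 (V : finType) (e : rel V) (s : mts_state V) (v : V) :=
  {| st_S := st_S s; st_L := st_L s; st_U := st_U s :\ v;
     st_k := fun u => if u \in nbr_out e v :&: st_U s
                      then Num.max (st_k s u - 1) 0 else st_k s u;
     st_delta := fun u => if (u \in nbr_out e v :&: st_U s) && (v \notin st_L s)
                          then st_delta s u - 1 else st_delta s u |}.

Definition mts_update2 (V : finType) (e : rel V) (s : mts_state V) (v : V) :=
  {| st_S := v |: st_S s; st_L := st_L s; st_U := st_U s :\ v;
     st_k := fun u => if u \in nbr_out e v :&: st_U s
                      then st_k s u - 1 else st_k s u;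
     st_delta := fun u => if u \in nbr_out e v :&: st_U s
                          then st_delta s u - 1 else st_delta s u |}.

Definition mts_update3 (V : finType) (e : rel V) (s : mts_state V) (v : V) :=
  {| st_S := st_S s; st_L := v |: st_L s; st_U := st_U s;
     st_k := st_k s;
     st_delta := fun u => if u \in nbr_out e v :&: st_U s
                          then st_delta s u - 1 else st_delta s u |}.

(* One iteration of the while loop; its guard U <> set0 is implied by the
   membership of the selected node in U. *)
Inductive mts_step (V : finType) (e : rel V) (s : mts_state V) :
    mts_state V -> Prop :=
| MtsCase1 v of case1_node s v : mts_step e s (mts_update1 e s v)
| MtsCase2 v of (forall u, ~~ case1_node s u) & case2_node s v :
    mts_step e s (mts_update2 e s v)
| MtsCase3 v of (forall u, ~~ case1_node s u) & (forall u, ~~ case2_node s u)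
    & case3_node s v : mts_step e s (mts_update3 e s v).

Definition mts_reachable (V : finType) (e : rel V) (t : V -> nat)
    (s : mts_state V) : Prop :=
  clos_refl_trans _ (mts_step e) (mts_init e t) s.

(* Every execution reaches the return statement: there is no infinite
   execution, and none gets stuck while U is nonempty. *)
Definition mts_always_returns (V : finType) (e : rel V) (t : V -> nat) : Prop :=
  Acc (fun s' s => mts_step e s s') (mts_init e t) /\
  forall s, mts_reachable e t s -> st_U s <> set0 -> exists s', mts_step e s s'.

Definition mts_output (V : finType) (e : rel V) (t : V -> nat)
    (S : {set V}) : Prop :=
  exists s, [/\ mts_reachable e t s, st_U s = set0 & st_S s = S].

(* Main.v *)
Require Import Defs.
From mathcomp Require Import all_boot all_order all_algebra.
From mathcomp Require Import zify ring lra.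
From Stdlib Require Import Relation_Operators Operators_Properties Wf_nat.
Set Implicit Arguments.
Unset Strict Implicit.
Unset Printing Implicit Defensive.
Import Order.TTheory GRing.Theory Num.Theory.
Local Open Scope ring_scope.

(** Give each node of U \ L the charge min(1, k / (delta + 1)).  The size of S
    plus the total charge never increases: deleting a node lowers both counters
    of its neighbours, which lowers their charges; a node entering S pays with
    its own charge, which is 1; and when v enters L, each of its delta(v)
    neighbours in U \ L gains at most the maximal ratio
    k(v) / (delta(v) (delta(v) + 1)), in total at most the charge that v gives
    up.  S is a target set since the deleted nodes are always activated by S.
    The algorithm cannot get stuck with U included in L: when the last node of U
    to enter L did so, its threshold k was at most its number delta of
    neighbours in U \ L, and all of these have been deleted since. *)

Lemma intr_max (R : numDomainType) (m n : int) :
  (Num.max m n)%:~R = Num.max m%:~R n%:~R :> R.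
Proof. by rewrite /Order.max ltr_int; case: ifP. Qed.

Lemma cardsDD1 (T : finType) (A B : {set T}) (x : T) :
  #|A :\: (B :\ x)| = ((x \in A :&: B) + #|A :\: B|)%N.
Proof.
have := cardsID (B :\ x) A; have := cardsID B A.
by rewrite setIDA (cardsD1 x (A :&: B)); lia.
Qed.

Section Charge.

Variable F : realFieldType.
Implicit Types k d : F.

Definition charge k d : F := Num.min 1 (k / (d + 1)).

Lemma charge_saturated k d : 0 <= d -> d + 1 <= k -> charge k d = 1.
Proof. by move=> d_ge0 k_large; rewrite /charge min_l // ler_pdivlMr; lra. Qed.

Lemma charge_unsaturated k d : 0 <= d -> k <= d + 1 -> charge k d = k / (d + 1).
Proof. by move=> d_ge0 k_le; rewrite /charge min_r // ler_pdivrMr; lra. Qed.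

Lemma charge_ge0 k d : 0 <= k -> 0 <= d -> 0 <= charge k d.
Proof. by move=> k_ge0 d_ge0; rewrite le_min ler01 divr_ge0 ?addr_ge0. Qed.

Lemma charge_homo d : 0 <= d -> {homo charge^~ d : k k' / k <= k'}.
Proof.
move=> d_ge0 k k' le_kk'; rewrite le_min !ge_min lexx /=; apply/orP; right.
by rewrite ler_wpM2r // invr_ge0 addr_ge0.
Qed.

Lemma charge_pred_le k d :
  0 <= k -> 0 < d -> charge (Num.max (k - 1) 0) (d - 1) <= charge k d.
Proof.
move=> k_ge0 d_gt0; have [k_large|/ltW k_le] := leP (d + 1) k.
  by rewrite (charge_saturated (ltW d_gt0) k_large) ge_min lexx.
have [k_le1|/ltW k_ge1] := leP k 1.
  rewrite max_r; last by rewrite subr_le0.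
  by rewrite [leLHS]min_r ?mul0r // charge_ge0 // ltW.
rewrite max_l; last by rewrite subr_ge0.
rewrite (charge_unsaturated (ltW d_gt0) k_le) ge_min subrK; apply/orP; right.
by rewrite ler_pdivrMr // mulrAC ler_pdivlMr; lra.
Qed.

Lemma charge_pred_delta_le k d :
  0 <= k -> 0 < d -> charge k (d - 1) <= charge k d + k / (d * (d + 1)).
Proof.
move=> k_ge0 d_gt0; have [k_large|/ltW k_le] := leP (d + 1) k.
  rewrite (charge_saturated (ltW d_gt0) k_large) ge_min lerDl divr_ge0 //.
  by rewrite mulr_ge0 ?addr_ge0 // ltW.
rewrite (charge_unsaturated (ltW d_gt0) k_le) ge_min subrK; apply/orP; right.
rewrite le_eqVlt; apply/orP; left; apply/eqP; field.
by rewrite !lt0r_neq0 //; lra.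
Qed.

Lemma charge_ratioE k d :
  0 < d -> k <= d + 1 -> charge k d = k / (d * (d + 1)) * d.
Proof.
move=> d_gt0 k_le; rewrite (charge_unsaturated (ltW d_gt0) k_le); field.
by rewrite !lt0r_neq0 //; lra.
Qed.

End Charge.

Section Activation.

Variables (V : finType) (e : rel V) (t : V -> nat).
Implicit Types (S A : {set V}) (v : V).

Lemma activation_homo l :
  {homo activation e t ^~ l : S S' / S \subset S'}.
Proof.
move=> S S' sSS'; elim: l => [|l IHl] //=; apply: setUSS => //.
apply/subsetP=> u; rewrite !inE => /leq_trans; apply.
by apply: subset_leq_card; apply: setIS.
Qed.

Lemma sub_activation S l : S \subset activation e t S l.
Proof. by elim: l => [|l IHl] //=; rewrite subsetU // IHl. Qed.

Definition activates S A : Prop := exists l, A \subset activation e t S l.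

Lemma activates0 S : activates S set0.
Proof. by exists 0%N; apply: sub0set. Qed.

Lemma activatesS S S' A : S \subset S' -> activates S A -> activates S' A.
Proof.
move=> sSS' [l sA]; exists l.
exact: subset_trans sA (activation_homo l sSS').
Qed.

Lemma activatesU1_seed S A v : v \in S -> activates S A -> activates S (v |: A).
Proof.
move=> vS [l sA]; exists l; rewrite subUset sA sub1set andbT.
by rewrite (subsetP (sub_activation S l)).
Qed.

Lemma activatesU1 S A v :
  (t v <= #|nbr_in e v :&: A|)%N -> activates S A -> activates S (v |: A).
Proof.
move=> le_t [l sA]; exists l.+1 => /=; rewrite subUset sub1set !inE.
rewrite (subset_trans sA (subsetUl _ _)) andbT.
by rewrite (leq_trans le_t) ?orbT // subset_leq_card // setIS.
Qed.

Lemma activates_setT S : activates S [set: V] -> is_target_set e t S.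
Proof. by case=> l; rewrite subTset => /eqP; exists l. Qed.

End Activation.

Section Counters.

Variables (V : finType) (e : rel V) (t : V -> nat).
Implicit Types (s : mts_state V) (u v : V).

Definition candidates s : {set V} := st_U s :\: st_L s.

Record counters_inv s : Prop := CountersInv {
  inv_k_ge0 : {in st_U s, forall u, 0 <= st_k s u};
  inv_threshold_le : {in st_U s, forall u,
    (t u)%:Z <= st_k s u + #|nbr_in e u :\: st_U s|%:Z};
  inv_deltaE : {in st_U s, forall u,
    st_delta s u = #|nbr_in e u :&: candidates s|%:Z} }.

(* The common effect of Cases 1 and 2, except on S. *)
Record deletion s v s' : Prop := Deletion {
  del_U : st_U s' = st_U s :\ v;
  del_L : st_L s' = st_L s;
  del_k : {in st_U s, forall u,
    st_k s' u = if e v u then Num.max (st_k s u - 1) 0 else st_k s u};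
  del_delta : {in st_U s, forall u,
    st_delta s' u = if e v u && (v \notin st_L s) then st_delta s u - 1
                    else st_delta s u} }.

Lemma candidates_deletion s v s' :
  deletion s v s' -> candidates s' = candidates s :\ v.
Proof.
by move=> del; rewrite /candidates (del_U del) (del_L del) setDDl setUC -setDDl.
Qed.

Lemma candidates_update3 s v :
  candidates (mts_update3 e s v) = candidates s :\ v.
Proof. by rewrite /candidates /= setUC -setDDl. Qed.

Lemma case1_free_k_gt0 s :
  counters_inv s -> (forall u, ~~ case1_node s u) ->
  {in st_U s, forall u, 0 < st_k s u}.
Proof.
move=> s_inv no_case1 u uU; rewrite lt0r inv_k_ge0 // andbT.
by have := no_case1 u; rewrite /case1_node uU.
Qed.

Lemma case2_free_k_le_delta s :
  (forall u, ~~ case2_node s u) ->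
  {in candidates s, forall u, st_k s u <= st_delta s u}.
Proof.
by move=> no_case2 u uC; have := no_case2 u; rewrite /case2_node uC /= -leNgt.
Qed.

Lemma deletion_update1 s v : deletion s v (mts_update1 e s v).
Proof. by split=> //= u uU; rewrite !inE uU andbT. Qed.

Lemma deletion_update2 s v :
  counters_inv s -> (forall u, ~~ case1_node s u) -> v \notin st_L s ->
  deletion s v (mts_update2 e s v).
Proof.
move=> s_inv no_case1 vL; split=> //= u uU; rewrite !inE uU ?vL !andbT //.
by case: ifP => // _; have := case1_free_k_gt0 s_inv no_case1 uU; lia.
Qed.

Lemma init_counters : counters_inv (mts_init e t).
Proof.
split=> //= u _; first by lia.
by rewrite /candidates /= setD0 setIT.
Qed.

Lemma deletion_counters s v s' :
  counters_inv s -> deletion s v s' -> v \in st_U s -> counters_inv s'.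
Proof.
move=> s_inv del vU.
have sub_U u : u \in st_U s' -> u \in st_U s.
  by rewrite (del_U del) => /setD1P[].
split=> u /sub_U uU.
- by rewrite (del_k del) //; have := inv_k_ge0 s_inv uU; case: ifP; lia.
- rewrite (del_k del) // (del_U del) cardsDD1 !inE vU andbT.
  by have := inv_threshold_le s_inv uU; case: (e v u); lia.
rewrite (del_delta del) // (candidates_deletion del) (inv_deltaE s_inv) //.
rewrite setIDA (cardsD1 v (nbr_in e u :&: candidates s)) !inE vU andbT.
by case: ifP; lia.
Qed.

Lemma update3_counters s v :
  counters_inv s -> v \in candidates s -> counters_inv (mts_update3 e s v).
Proof.
move=> s_inv vC; split=> u uU.
- exact: (inv_k_ge0 s_inv).
- exact: (inv_threshold_le s_inv).
rewrite candidates_update3 /= !inE (inv_deltaE s_inv) // [u \in st_U s]uU andbT.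
rewrite setIDA (cardsD1 v (nbr_in e u :&: candidates s)) inE vC inE andbT.
by case: ifP; lia.
Qed.

Lemma step_counters s s' :
  counters_inv s -> mts_step e s s' -> counters_inv s'.
Proof.
move=> s_inv [v /andP[vU _]|v no_case1 /andP[/setDP[vU vL] _]|v _ _ [vC _]].
- exact: deletion_counters s_inv (deletion_update1 s v) vU.
- exact: deletion_counters s_inv (deletion_update2 s_inv no_case1 vL) vU.
exact: update3_counters.
Qed.

Lemma reachable_counters s : mts_reachable e t s -> counters_inv s.
Proof.
apply: clos_refl_trans_ind_left => [|r r' _]; first exact: init_counters.
exact: step_counters.
Qed.

Lemma reachable_invariant (P : mts_state V -> Prop) :
  P (mts_init e t) ->
  (forall s s', counters_inv s -> mts_step e s s' -> P s -> P s') ->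
  forall s, mts_reachable e t s -> P s.
Proof.
move=> P_init P_step; apply: clos_refl_trans_ind_left => // s s' run Ps step.
exact: P_step (reachable_counters run) step Ps.
Qed.

End Counters.

Section TargetSet.

Variables (V : finType) (e : rel V) (t : V -> nat).
Implicit Type s : mts_state V.

Lemma step_activates s s' :
  counters_inv e t s -> mts_step e s s' ->
  activates e t (st_S s) (~: st_U s) -> activates e t (st_S s') (~: st_U s').
Proof.
move=> s_inv [v /andP[vU /eqP k_v0]|v _ _|//] act.
  rewrite /= setCD setUC; apply: activatesU1 => //; rewrite -setDE -lez_nat.
  by have := inv_threshold_le s_inv vU; rewrite k_v0 add0r.
rewrite /= setCD [~: _ :|: _]setUC.
apply: activatesU1_seed; first exact: setU11.
by apply: activatesS act; apply: subsetUr.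
Qed.

Lemma reachable_activates s :
  mts_reachable e t s -> activates e t (st_S s) (~: st_U s).
Proof.
move: s; apply: reachable_invariant => [|s s']; last exact: step_activates.
by rewrite /= setCT; apply: activates0.
Qed.

Lemma mts_output_target_set (S : {set V}) :
  mts_output e t S -> is_target_set e t S.
Proof.
case=> s [/reachable_activates act U_empty <-]; apply: activates_setT.
by rewrite -setC0 -U_empty.
Qed.

End TargetSet.

Section Progress.

Variables (V : finType) (e : rel V) (t : V -> nat).
Implicit Types (s : mts_state V) (u v : V) (X : {set V}).

(* The choice of u in X replaces "the last node of X to enter L", so that the
   order of insertion need not be recorded. *)
Definition waiting_supported s : Prop :=
  forall X, X \subset st_U s :&: st_L s -> X != set0 ->
  exists2 u, u \in X & st_k s u <= #|nbr_in e u :&: (st_U s :\: X)|%:Z.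

Lemma init_waiting : waiting_supported (mts_init e t).
Proof. by move=> X; rewrite setI0 subset0 => /eqP->; rewrite eqxx. Qed.

Lemma deletion_waiting s v s' :
  deletion e s v s' -> v \in st_U s ->
  waiting_supported s -> waiting_supported s'.
Proof.
move=> del vU s_wait X; rewrite (del_U del) (del_L del) => sX X_neq0.
have sX_UL : X \subset st_U s :&: st_L s.
  by apply: subset_trans sX _; apply: setSI; apply: subsetDl.
have vNX : v \notin X by apply/negP=> /(subsetP sX); rewrite !inE eqxx.
have [u uX le_k] := s_wait X sX_UL X_neq0; exists u => //.
have uU : u \in st_U s by case/setIP: (subsetP sX_UL u uX).
rewrite (del_k del) // setDDl setUC -setDDl setIDA; move: le_k.
rewrite (cardsD1 v (nbr_in e u :&: _)) !inE vU vNX andbT.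
by case: (e v u); rewrite /=; lia.
Qed.

Lemma update3_waiting s v :
  irreflexive e -> counters_inv e t s -> (forall u, ~~ case2_node s u) ->
  v \in candidates s -> waiting_supported s ->
  waiting_supported (mts_update3 e s v).
Proof.
move=> e_irr s_inv no_case2 vC s_wait X /subsetP sX X_neq0.
have [vX|vNX] := boolP (v \in X); last first.
  apply: s_wait => //; apply/subsetP=> x xX; have := sX x xX; rewrite !inE.
  by case: (eqVneq x v) => // x_v; rewrite -x_v xX in vNX.
exists v => //; apply: le_trans (case2_free_k_le_delta no_case2 vC) _.
have /setDP[vU _] := vC; rewrite (inv_deltaE s_inv) // lez_nat.
apply/subset_leq_card/subsetP=> x; rewrite !inE => /and3P[exv xL ->].
rewrite exv andbT /=; apply/negP=> /sX; rewrite !inE (negbTE xL) orbF.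
by case/andP=> _ /eqP x_v; rewrite x_v e_irr in exv.
Qed.

Lemma step_waiting s s' :
  irreflexive e -> counters_inv e t s -> mts_step e s s' ->
  waiting_supported s -> waiting_supported s'.
Proof.
move=> e_irr s_inv.
case=> [v /andP[vU _]|v no_case1 /andP[/setDP[vU vL] _]|v _ no_case2 [vC _]].
- exact: deletion_waiting (deletion_update1 e s v) vU.
- exact: deletion_waiting (deletion_update2 s_inv no_case1 vL) vU.
exact: update3_waiting.
Qed.

Lemma reachable_waiting s :
  irreflexive e -> mts_reachable e t s -> waiting_supported s.
Proof.
move=> e_irr; move: s; apply: reachable_invariant => [|s s'].
  exact: init_waiting.
exact: step_waiting.
Qed.

Lemma waiting_progress s :
  counters_inv e t s -> waiting_supported s -> st_U s <> set0 ->
  exists s', mts_step e s s'.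
Proof.
move=> s_inv s_wait /eqP U_neq0.
have [/existsP[v v_case1]|/existsPn no_case1] :=
  boolP [exists v, case1_node s v].
  by exists (mts_update1 e s v); apply: MtsCase1.
have [/existsP[v v_case2]|/existsPn no_case2] :=
  boolP [exists v, case2_node s v].
  by exists (mts_update2 e s v); apply: MtsCase2.
have [no_candidate|[v0 v0C]] := set_0Vmem (candidates s).
  have sub_UL : st_U s \subset st_U s :&: st_L s.
    by rewrite subsetI subxx -setD_eq0 -/(candidates s) no_candidate eqxx.
  have [u uU] := s_wait _ sub_UL U_neq0; rewrite setDv setI0 cards0.
  by rewrite leNgt (case1_free_k_gt0 s_inv no_case1 uU).
have [v vC v_max] := Order.TotalTheory.arg_maxP (mts_ratio s) v0C.
by exists (mts_update3 e s v); apply: MtsCase3.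
Qed.

Definition remaining s : nat := #|st_U s| + #|~: st_L s|.

Lemma step_remaining_lt s s' :
  mts_step e s s' -> (remaining s' < remaining s)%N.
Proof.
rewrite /remaining.
case=> [v /andP[vU _]|v _ /andP[/setDP[vU _] _]|v _ _ [/setDP[_ vL] _]] /=.
- by rewrite (cardsD1 v (st_U s)) vU; lia.
- by rewrite (cardsD1 v (st_U s)) vU; lia.
by rewrite (cardsD1 v (~: st_L s)) inE vL setCU setIC -setDE; lia.
Qed.

Lemma mts_step_wf : well_founded (fun s' s => mts_step e s s').
Proof.
apply: (@well_founded_lt_compat _ remaining).
by move=> s' s /step_remaining_lt/ssrnat.ltP.
Qed.

Lemma mts_returns : irreflexive e -> mts_always_returns e t.
Proof.
move=> e_irr; split=> [|s run]; first exact: mts_step_wf.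
exact: waiting_progress (reachable_counters run) (reachable_waiting e_irr run).
Qed.

End Progress.

Section Budget.

Variables (V : finType) (e : rel V) (t : V -> nat).
Implicit Types (s : mts_state V) (u v : V).

Definition node_charge s u : rat := charge (st_k s u)%:~R (st_delta s u)%:~R.

Definition budget s : rat :=
  #|st_S s|%:R + \sum_(u in candidates s) node_charge s u.

Lemma budget_init :
  budget (mts_init e t) = \sum_v charge (t v)%:R #|nbr_in e v|%:R.
Proof.
rewrite /budget /candidates /= cards0 add0r setD0.
by apply: eq_bigl => u; rewrite inE.
Qed.

Lemma node_charge_ge0 s u :
  counters_inv e t s -> u \in st_U s -> 0 <= node_charge s u.
Proof.
move=> s_inv uU; rewrite charge_ge0 ?ler0z ?(inv_k_ge0 s_inv) //.
by rewrite (inv_deltaE s_inv).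
Qed.

Lemma deletion_node_charge_le s v s' u :
  counters_inv e t s -> deletion e s v s' -> v \in st_U s ->
  u \in candidates s -> node_charge s' u <= node_charge s u.
Proof.
move=> s_inv del vU /setDP[uU _]; have k_ge0 := inv_k_ge0 s_inv uU.
have deltaE := inv_deltaE s_inv uU.
rewrite /node_charge (del_k del) // (del_delta del) //.
have [evu|//] := boolP (e v u); have [vL|vNL] /= := boolP (v \in st_L s).
  by apply: charge_homo; rewrite ?ler_int ?deltaE //; lia.
rewrite intr_max !intrB charge_pred_le ?ler0z ?ltr0z //.
rewrite deltaE ltz_nat card_gt0; apply/set0Pn.
by exists v; rewrite !inE evu vNL vU.
Qed.

Lemma deletion_sum_charge_le s v s' :
  counters_inv e t s -> deletion e s v s' -> v \in st_U s ->
  \sum_(u in candidates s') node_charge s' u <=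
    \sum_(u in candidates s :\ v) node_charge s u.
Proof.
move=> s_inv del vU; rewrite (candidates_deletion del).
by apply: ler_sum => u /setD1P[_]; apply: deletion_node_charge_le del vU.
Qed.

Lemma update1_budget_le s v :
  counters_inv e t s -> case1_node s v ->
  budget (mts_update1 e s v) <= budget s.
Proof.
move=> s_inv /andP[vU _]; rewrite lerD2l.
apply: le_trans (deletion_sum_charge_le s_inv (deletion_update1 e s v) vU) _.
have [vC|vNC] := boolP (v \in candidates s).
  by rewrite [leRHS](big_setD1 v) //= lerDr node_charge_ge0.
by rewrite (setDidPl _) // disjoint_sym disjoints1.
Qed.

Lemma case2_node_charge s v :
  counters_inv e t s -> case2_node s v -> node_charge s v = 1.
Proof.
move=> s_inv /andP[/setDP[vU _] lt_delta_k].
rewrite /node_charge charge_saturated ?ler0z ?(inv_deltaE s_inv) //.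
by rewrite -(inv_deltaE s_inv vU) -(intrD _ _ 1) ler_int lezD1.
Qed.

Lemma update2_budget_le s v :
  counters_inv e t s -> (forall u, ~~ case1_node s u) -> case2_node s v ->
  budget (mts_update2 e s v) <= budget s.
Proof.
move=> s_inv no_case1 v_case2.
have /andP[vC _] := v_case2; have /setDP[vU vL] := vC.
have del := deletion_update2 s_inv no_case1 vL.
rewrite /budget [in leRHS](big_setD1 v) //= (case2_node_charge s_inv v_case2).
rewrite addrA lerD ?(deletion_sum_charge_le s_inv del) //.
by rewrite natr1 ler_nat cardsU1; case: (v \notin _).
Qed.

Section Case3.

Variables (s : mts_state V) (v : V).
Hypotheses (s_inv : counters_inv e t s) (v_case3 : case3_node s v).
Hypotheses (no_case1 : forall u, ~~ case1_node s u)
  (no_case2 : forall u, ~~ case2_node s u).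

Lemma case3_counters_gt0 u :
  u \in candidates s -> 0 < st_k s u /\ 0 < st_delta s u.
Proof.
move=> uC; have /setDP[uU _] := uC.
have k_gt0 := case1_free_k_gt0 s_inv no_case1 uU; split=> //.
exact: lt_le_trans k_gt0 (case2_free_k_le_delta no_case2 uC).
Qed.

Lemma update3_node_charge u :
  u \in candidates s ->
  node_charge (mts_update3 e s v) u <=
    node_charge s u + (if e v u then mts_ratio s v else 0).
Proof.
move=> uC; have [k_gt0 delta_gt0] := case3_counters_gt0 uC.
have /setDP[uU _] := uC; rewrite /node_charge /= !inE uU andbT.
case: ifP => _; last by rewrite addr0.
rewrite intrB; apply: le_trans (charge_pred_delta_le _ _) _.
- by rewrite ler0z ltW.
- by rewrite ltr0z.
by rewrite lerD2l; apply: (proj2 v_case3).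
Qed.

Lemma case3_sum_ratioE :
  is_undirected e ->
  \sum_(u in candidates s :\ v) (if e v u then mts_ratio s v else 0) =
    node_charge s v.
Proof.
move=> [e_sym e_irr]; have [vC _] := v_case3; have /setDP[vU _] := vC.
have [_ delta_gt0] := case3_counters_gt0 vC.
have -> : node_charge s v = mts_ratio s v * (st_delta s v)%:~R.
  rewrite /node_charge charge_ratioE ?ltr0z // ler_wpDr // ler_int.
  exact: case2_free_k_le_delta.
rewrite -big_mkcondr sumr_const -[LHS]mulr_natr (inv_deltaE s_inv) // -pmulrn.
congr (_ * _%:R); apply: eq_card => u.
rewrite [LHS]unfold_in /= !inE [e u v]e_sym.
by case: (eqVneq u v) => [->|_] /=; rewrite ?e_irr // andbC.
Qed.

Lemma update3_budget_le :
  is_undirected e -> budget (mts_update3 e s v) <= budget s.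
Proof.
move=> e_undir; have [vC _] := v_case3.
rewrite lerD2l candidates_update3 [leRHS](big_setD1 v) //=.
rewrite -(case3_sum_ratioE e_undir) addrC -big_split.
by apply: ler_sum => u /setD1P[_]; apply: update3_node_charge.
Qed.

End Case3.

Lemma step_budget_le s s' :
  is_undirected e -> counters_inv e t s -> mts_step e s s' ->
  budget s' <= budget s.
Proof.
move=> e_undir s_inv [v v_case1|v no_case1 v_case2|v no_case1 no_case2 v_case3].
- exact: update1_budget_le.
- exact: update2_budget_le.
exact: update3_budget_le.
Qed.

Lemma reachable_budget_le s :
  is_undirected e -> mts_reachable e t s -> budget s <= budget (mts_init e t).
Proof.
move=> e_undir; move: s; apply: reachable_invariant => // s s' s_inv step.
exact: le_trans (step_budget_le e_undir s_inv step).
Qed.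

Lemma degree_nbr_in v : symmetric e -> degree e v = #|nbr_in e v|.
Proof. by move=> e_sym; apply: eq_card => u; rewrite !inE e_sym. Qed.

Lemma mts_output_card_le (S : {set V}) :
  is_undirected e -> mts_output e t S ->
  #|S|%:R <= \sum_v charge ((t v)%:R : rat) (degree e v)%:R.
Proof.
move=> e_undir [s [/(reachable_budget_le e_undir) le_budget U_empty <-]].
under eq_bigr do rewrite (degree_nbr_in _ (proj1 e_undir)).
rewrite -budget_init; apply: le_trans le_budget.
by rewrite /budget /candidates U_empty set0D big_set0 addr0.
Qed.

End Budget.

Theorem theorem5 (V : finType) (e : rel V) (t : V -> nat)
    (he : is_undirected e) :
  mts_always_returns e t /\
  forall S : {set V}, mts_output e t S ->
    is_target_set e t S /\
    (#|S|%:R : rat) <=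
      \sum_(v : V) Num.min 1 ((t v)%:R / ((degree e v)%:R + 1)).
Proof.
split=> [|S outS]; first exact: mts_returns (proj2 he).
split; first exact: mts_output_target_set outS.
exact: mts_output_card_le he outS.
Qed.
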